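(* Let $I\subset K[x,y,z]$ be an Artinian monomial ideal, and write $R=K[x,y,z]$, such that $R/I$ has the weak Lefschetz property in characteristic zero. If $I$ contains the powers $x^a,y^b,z^c$, then $R/I$ has the weak Lefschetz property in positive characteristic whenever $$\operatorname{char} K>3^{\frac12\binom{\frac12(a+b+c)+2}{2}}.$$
   Context: The field $K$ is infinite. An Artinian standard graded $K$-algebra $A$ has the weak Lefschetz property if there is a linear form $\ell\in[A]_1$ such that for all integers $j$ the multiplication map $\times\ell:[A]_j\to[A]_{j+1}$ has maximal rank (is injective or surjective). The monomials generating $I$ are fixed, and ''$R/I$ has the weak Lefschetz property in characteristic $p$'' means that the quotient of the polynomial ring in $x,y,z$ over an infinite field of characteristic $p$ by the ideal generated by these same monomials has the weak Lefschetz property. For real $u$, $\binom{u}{2}=\frac{u(u-1)}{2}$. *)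

(* Defs.v *)
From HB Require Import structures.
From mathcomp Require Import all_boot all_order all_algebra.
From mathcomp Require Import boolp classical_sets cardinality reals exp.
From mathcomp Require Import mpoly.

Set Implicit Arguments.
Unset Strict Implicit.
Unset Printing Implicit Defensive.

Import Order.TTheory GRing.Theory Num.Theory.

Local Open Scope classical_set_scope.
Local Open Scope ring_scope.

Section Ideals.
Variable P : comNzRingType.

Definition is_ideal (J : set P) : Prop :=
  [/\ J 0, forall f g, J f -> J g -> J (f + g) & forall f g, J g -> J (f * g)].

Definition ideal_gen (S : set P) : set P :=
  [set f | exists2 r : seq (P * P), (forall t, t \in r -> S t.2)
           & f = \sum_(t <- r) t.1 * t.2].

Definition eq_mod (I : set P) (f g : P) : Prop := I (f - g).

(* P/I is an Artinian ring: the ideals of P/I are the J/I for J an ideal of P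
   containing I, so this is the descending chain condition in P/I. *)
Definition artinian_ideal (I : set P) : Prop :=
  forall J : nat -> set P,
    (forall n, is_ideal (J n)) -> (forall n, I `<=` J n) ->
    (forall n, J n.+1 `<=` J n) ->
  exists N, forall n, (N <= n)%N -> J n = J N.

End Ideals.

Section Lefschetz.
Variables (n : nat) (K : fieldType).
Implicit Types (I : set {mpoly K[n]}) (ell f g h : {mpoly K[n]}) (j : int).

(* Same as [f \is d.-homog], but with degrees in Z; it is {0} for j < 0. *)
Definition degree_part j : set {mpoly K[n]} :=
  [set f | all (fun m => (mdeg m)%:Z == j) (msupp f)].

(* For a homogeneous ideal I and A = K[x_1..x_n]/I, the elements of [A]_j are
   the classes of the elements of degree_part j.  The next two definitions
   are about the map [A]_j -> [A]_(j+1) sending the class of f to the class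
   of ell * f, written on representatives. *)
Definition mul_injective I ell j : Prop :=
  forall f g, degree_part j f -> degree_part j g ->
    eq_mod I (ell * f) (ell * g) -> eq_mod I f g.

Definition mul_surjective I ell j : Prop :=
  forall h, degree_part (j + 1) h ->
    exists2 f, degree_part j f & eq_mod I (ell * f) h.

Definition weak_lefschetz I : Prop :=
  exists2 ell, degree_part 1 ell &
    forall j, mul_injective I ell j \/ mul_surjective I ell j.

End Lefschetz.

(* The generating monomials are given by their exponents, so that the same
   family G defines an ideal over every field K. *)
Definition monomial_ideal (n : nat) (K : fieldType) (G : set 'X_{1..n}) :
    set {mpoly K[n]} :=
  ideal_gen [set 'X_[K, m] | m in G].
Arguments monomial_ideal {n} K G _.

Definition binom2 (R : realType) (u : R) : R := u * (u - 1) / 2.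

(* Main.v *)
(** A linear form [ell] acts on the standard monomials (those outside the ideal)
    through matrices whose maximal minors are, up to a monomial in the
    coefficients of [ell], those of [ell = x + y + z]; so [x + y + z] is a weak
    Lefschetz element in characteristic zero.  Its matrices are 0/1 with at most
    three ones in each row, so by Hadamard's inequality a nonzero minor of size
    [N] is an integer of absolute value at most [3^(N/2)].  The number [N] of
    standard monomials of any degree is bounded by that of the complete
    intersection [(x^a, y^b, z^c)], whose Hilbert function is symmetric, and the
    hypothesis on [p] then says that no nonzero minor vanishes modulo [p]. *)
Require Import Defs.
From mathcomp Require Import all_boot all_order all_algebra.
From mathcomp Require Import boolp classical_sets cardinality reals exp.
From mathcomp Require Import mpoly.
From mathcomp Require Import ring lra zify.

Set Implicit Arguments.
Unset Strict Implicit.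
Unset Printing Implicit Defensive.

Import Order.TTheory GRing.Theory Num.Theory.

Local Open Scope classical_set_scope.
Local Open Scope ring_scope.

(** * Gram determinants and Hadamard's inequality *)

Section Hadamard.
Variable R : realFieldType.

Lemma gram_diag_ge0 m n (A : 'M[R]_(m, n)) i : 0 <= (A *m A^T) i i.
Proof. by rewrite mxE sumr_ge0 // => k _; rewrite mxE -expr2 sqr_ge0. Qed.

Lemma gram_eq0 m n (A : 'M[R]_(m, n)) : A *m A^T = 0 -> A = 0.
Proof.
move=> A0; apply/matrixP=> i j; rewrite mxE.
have /eqP := congr1 (fun M : 'M_m => M i i) A0.
rewrite !mxE psumr_eq0 => [/allP /(_ j)|k _]; last first.
  by rewrite mxE -expr2 sqr_ge0.
by rewrite mem_index_enum mxE -expr2 sqrf_eq0 => /(_ isT)/eqP.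
Qed.

(** Induction on the number of rows: replacing the first row [v] by its component orthogonal to the
    other rows keeps the Gram determinant, makes the Gram matrix block diagonal and can only shorten
    the row. *)
Lemma gram_det_le m n (A : 'M[R]_(m, n)) :
  0 <= \det (A *m A^T) <= \prod_i (A *m A^T) i i.
Proof.
elim: m A => [|m IHm] A; first by rewrite det_mx00 big_ord0 ler01 lexx.
rewrite -[A](@vsubmxK _ 1 m); set v := usubmx _; set B := dsubmx _.
have [/andP[detB_ge0 detB_le] prodE] := (IHm B, big_ord_recl).
rewrite prodE.
have colE : (col_mx v B *m (col_mx v B)^T) =
    block_mx (v *m v^T) (v *m B^T) (B *m v^T) (B *m B^T) :> 'M_(1 + m).
  by rewrite tr_col_mx mul_col_row.
have -> : (col_mx v B *m (col_mx v B)^T) ord0 ord0 = (v *m v^T) 0 0.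
  rewrite colE; have -> : ord0 = lshift m (0 : 'I_1) by apply/val_inj.
  by rewrite block_mxEul.
under eq_bigr => i _.
  have -> : (col_mx v B *m (col_mx v B)^T) (lift ord0 i) (lift ord0 i)
      = (B *m B^T) i i.
    rewrite colE; have -> : lift ord0 i = rshift 1 i by apply/val_inj.
    by rewrite block_mxEdr.
  over.
(* If the Gram matrix of [B] is singular, a kernel vector [u] satisfies [u *m B = 0], because
   [u *m B] has zero Gram matrix; the rows of the whole matrix are then dependent and its Gram
   determinant is zero. *)
have [uB|] := boolP (B *m B^T \in unitmx); last first.
  rewrite unitmxE unitfE negbK => /det0P[u nz_u uBB].
  have uB0 : u *m B = 0.
    by apply: gram_eq0; rewrite trmx_mul mulmxA -(mulmxA u) uBB mul0mx.
  suff -> : \det (col_mx v B *m (col_mx v B)^T) = 0.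
    rewrite lexx mulr_ge0 ?gram_diag_ge0 ?prodr_ge0 // => i _.
    exact: gram_diag_ge0.
  apply/eqP/det0P; exists (row_mx (0 : 'M_1) u).
    apply: contra nz_u => /eqP; rewrite -[X in _ = X]row_mx0.
    by case/eq_row_mx=> _ ->.
  by rewrite mulmxA mul_row_col mul0mx uB0 addr0 mul0mx.
(* [w] is the component of [v] orthogonal to the rows of [B]. *)
have [e [w [defv wB]]] : exists (e : 'rV_m) (w : 'rV_n),
    v = w + e *m B /\ w *m B^T = 0.
  exists (v *m B^T *m invmx (B *m B^T)).
  exists (v - v *m B^T *m invmx (B *m B^T) *m B); split; first by rewrite subrK.
  by rewrite mulmxBl -!mulmxA mulVmx // mulmx1 subrr.
have Bw : B *m w^T = 0 by rewrite -[LHS]trmxK trmx_mul trmxK wB trmx0.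
(* The unitriangular [L] adds [e *m B] back to [w]. *)
pose L : 'M_(1 + m) := block_mx 1%:M e 0 1%:M.
have detL : \det L = 1 by rewrite det_ublock !det1 mulr1.
have -> : col_mx v B = L *m col_mx w B.
  by rewrite mul_block_col !mul1mx mul0mx add0r {1}defv.
rewrite trmx_mul mulmxA -(mulmxA L) !det_mulmx det_tr detL mul1r mulr1.
rewrite tr_col_mx mul_col_row wB Bw (@det_ublock _ 1 m) det_mx11.
have w_ge0 := gram_diag_ge0 w 0.
rewrite mulr_ge0 //= ler_pM //.
(* Pythagoras: the cross terms vanish, so the squared norm of [v] is that of [w] plus that of
   [e *m B]. *)
rewrite [in leRHS]defv [(w + _)^T]linearD /= trmx_mul mulmxDl !mulmxDr.
rewrite -[e *m B *m w^T]mulmxA Bw mulmx0 add0r mulmxA wB mul0mx addr0.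
by rewrite -trmx_mul [leRHS]mxE lerDl gram_diag_ge0.
Qed.

Lemma hadamard n (A : 'M[R]_n) : (\det A) ^+ 2 <= \prod_i \sum_j A i j ^+ 2.
Proof.
have /andP[_] := gram_det_le A.
rewrite det_mulmx det_tr -expr2 => /le_trans; apply.
rewrite le_eqVlt; apply/orP; left; apply/eqP/eq_bigr=> i _.
by rewrite mxE; apply: eq_bigr => j _; rewrite mxE.
Qed.

End Hadamard.

(** Bounding the square avoids a square root of [k] when [n] is odd. *)
Lemma hadamard_int n (A : 'M[int]_n) (k : nat) :
  (forall i, \sum_j A i j ^+ 2 <= k%:Z) -> (\det A) ^+ 2 <= (k ^ n)%:Z.
Proof.
move=> leAk; have := hadamard (map_mx intr A : 'M[rat]_n).
rewrite det_map_mx -rmorphXn /= => /le_trans leA.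
rewrite -(ler_int rat) leA // -pmulrn natrX -[X in _ <= _ ^+ X]card_ord.
rewrite -prodr_const; apply: ler_prod => i _.
apply/andP; split; first by apply: sumr_ge0 => j _; rewrite sqr_ge0.
rewrite pmulrn.
under eq_bigr => j _ do rewrite mxE -rmorphXn.
by rewrite -rmorph_sum ler_int.
Qed.

(** * Maximal rank through nonzero minors *)

Section Minors.
Variable F : fieldType.

(** Turns a rank condition into the nonvanishing of one determinant, which can be compared between
    fields of different characteristics. *)
Lemma row_full_minorP m n (M : 'M[F]_(m, n)) :
  row_full M <->
  exists2 f : 'I_n -> 'I_m, injective f & \det (rowsub f M) != 0.
Proof.
split=> [fullM|[f _]].
  exists (fullrankfun fullM); first exact: fullrankfun_inj.
  by rewrite -unitfE -unitmxE fullrowsub_unit.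
rewrite -unitfE -unitmxE -row_full_unit -!sub1mx => /submx_trans -> //.
exact: rowsub_sub.
Qed.

Lemma row_free_minorP m n (M : 'M[F]_(m, n)) :
  row_free M <->
  exists2 g : 'I_m -> 'I_n, injective g & \det (colsub g M) != 0.
Proof.
rewrite /row_free -mxrank_tr -/(row_full _) row_full_minorP.
by split=> -[g g_inj nz_g]; exists g => //; move: nz_g;
  rewrite -det_tr trmx_mxsub ?trmxK.
Qed.

End Minors.

(** * Ideals generated by a set *)

Section IdealGen.
Variables (P : comNzRingType) (S : set P).

Lemma ideal_gen_is_ideal : is_ideal (ideal_gen S).
Proof.
split; first by exists [::]; rewrite ?big_nil.
- move=> _ _ [r1 S1 ->] [r2 S2 ->]; exists (r1 ++ r2); last by rewrite big_cat.
  by move=> t; rewrite mem_cat => /orP[/S1|/S2].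
- move=> f _ [r Sr ->]; exists [seq (f * t.1, t.2) | t <- r].
    by move=> _ /mapP[t /Sr St ->].
  by rewrite big_map mulr_sumr; apply: eq_bigr => t _; rewrite mulrA.
Qed.

Lemma mem_ideal_gen f g : S g -> ideal_gen S (f * g).
Proof.
move=> Sg; exists [:: (f, g)]; last by rewrite big_seq1.
by move=> t; rewrite inE => /eqP ->.
Qed.

End IdealGen.

(** * Standard monomials of a monomial ideal *)

Section StandardMonomials.
Variables (n : nat) (G : set 'X_{1..n}).

(** Depends only on the exponents in [G], so the same monomials index the bases of the quotients
    over all fields. *)
Definition standard (m : 'X_{1..n}) : bool :=
  `[< forall g, G g -> ~~ (g <= m)%MM >].

Lemma standard_le m1 m2 : (m1 <= m2)%MM -> standard m2 -> standard m1.
Proof.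
move=> le_m /asboolP std2; apply/asboolP => g /std2; apply: contra.
by move/lepm_trans; apply.
Qed.

(** Every monomial occurring in a multiple of a generator is divisible by that generator;
    conversely, a polynomial whose monomials are all nonstandard is a sum of multiples of
    generators. *)
Lemma monomial_idealP (K : fieldType) (f : {mpoly K[n]}) :
  monomial_ideal K G f <-> forall m, standard m -> f@_m = 0.
Proof.
split=> [[r Gr ->] m /asboolP std_m|f0].
  rewrite raddf_sum big_seq big1 //= => t /Gr[g Gg <-].
  apply/eqP; rewrite mcoeff_eq0 (perm_mem (msuppMX _ _)).
  apply/mapP=> -[m' _ def_m]; have := std_m g Gg.
  by rewrite def_m lem_addr.
have [id0 idD _] := ideal_gen_is_ideal [set 'X_[K, m] | m in G].
rewrite [f]mpolyE big_seq; apply: big_ind => // m supp_m.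
have /asboolPn/existsNP[g /not_implyP[Gg /negP/negPn le_gm]] : ~~ standard m.
  by apply: contraL supp_m => /f0/eqP; rewrite mcoeff_eq0.
rewrite -(submK le_gm) mpolyXD scalerAl.
by apply: mem_ideal_gen; exists g.
Qed.

Lemma monomial_ideal_mpolyX (K : fieldType) m :
  monomial_ideal K G 'X_[m] <-> ~~ standard m.
Proof.
rewrite monomial_idealP; split=> [X0|nstd_m m' std_m'].
  by apply/negP => /X0/eqP; rewrite mcoeffX eqxx oner_eq0.
by rewrite mcoeffX; case: eqP => // mm'; rewrite mm' std_m' in nstd_m.
Qed.

Definition standard_seq d : seq 'X_{1..n} :=
  [seq m <- [seq s2m t | t : d.-tuple 'I_n <- enum (basis n d)] | standard m].

Lemma mem_standard_seq d m :
  (m \in standard_seq d) = standard m && (mdeg m == d).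
Proof. by rewrite mem_filter -basis_cover. Qed.

Lemma standard_seq_uniq d : uniq (standard_seq d).
Proof. by rewrite filter_uniq ?uniq_basis. Qed.

Definition standard_mon d (i : 'I_(size (standard_seq d))) : 'X_{1..n} :=
  nth 0%MM (standard_seq d) i.

Lemma standard_mon_mem d i : @standard_mon d i \in standard_seq d.
Proof. exact: mem_nth. Qed.

Lemma standard_mon_inj d : injective (@standard_mon d).
Proof.
move=> i j /eqP; rewrite nth_uniq ?standard_seq_uniq // => /eqP.
exact: val_inj.
Qed.

Lemma standard_monP d m :
  reflect (exists i, m = @standard_mon d i) (standard m && (mdeg m == d)).
Proof.
rewrite -mem_standard_seq; apply: (iffP (nthP 0%MM)) => [[i lt_i <-]|[i ->]].
  by exists (Ordinal lt_i).
by exists i.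
Qed.

Lemma mdeg_standard_mon d (i : 'I_(size (standard_seq d))) :
  mdeg (standard_mon i) = d.
Proof.
by have := standard_mon_mem i; rewrite mem_standard_seq => /andP[_ /eqP].
Qed.

Lemma standard_standard_mon d (i : 'I_(size (standard_seq d))) :
  standard (standard_mon i).
Proof.
by have := standard_mon_mem i; rewrite mem_standard_seq => /andP[].
Qed.

(** * Matrices of multiplication by a linear form, acting on row vectors *)

Definition mult_mx (R : nzRingType) (alpha : 'I_n -> R) d :
    'M[R]_(size (standard_seq d), size (standard_seq d.+1)) :=
  \matrix_(i, j)
    \sum_k alpha k *+ (standard_mon j == (standard_mon i + U_(k))%MM).

Lemma mult_mx_next (R : nzRingType) (alpha : 'I_n -> R) d i j k :
  standard_mon j = (standard_mon i + U_(k))%MM -> mult_mx alpha d i j = alpha k.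
Proof.
move=> def_j; rewrite mxE (bigD1 k) //= def_j eqxx big1 ?addr0 // => l ne_lk.
case: eqP => // /addmI /mnmP /(_ l)/eqP.
by rewrite !mnm1E eqxx [k == l]eq_sym (negPf ne_lk).
Qed.

Lemma mult_mx_other (R : nzRingType) (alpha : 'I_n -> R) d i j :
  ~ (exists k, standard_mon j = (standard_mon i + U_(k))%MM) ->
  mult_mx alpha d i j = 0.
Proof.
move=> no_k; rewrite mxE big1 // => k _; case: eqP => // def_j.
by case: no_k; exists k.
Qed.

(** Serves for three changes of scalars: integers to a field, constants to polynomials, and
    evaluation of polynomials. *)
Lemma mult_mx_map (R S : nzRingType) (h : {rmorphism R -> S}) alpha d :
  map_mx h (mult_mx alpha d) = mult_mx (h \o alpha) d.
Proof.
apply/matrixP=> i j; rewrite !mxE rmorph_sum; apply: eq_bigr => k _ /=.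
by rewrite rmorphMn.
Qed.

Lemma eq_mult_mx (R : nzRingType) (alpha beta : 'I_n -> R) d :
  alpha =1 beta -> mult_mx alpha d = mult_mx beta d.
Proof. by move/funext ->. Qed.

(** The entries are 0 or 1, hence equal to their squares, and each of the [n] variables contributes
    at most one 1 to a row, namely in the column of its product with the row's monomial. *)
Lemma mult_mx_row_norm d N (g : 'I_N -> 'I_(size (standard_seq d.+1))) i :
  injective g ->
  \sum_j mult_mx (fun=> 1 : int) d i (g j) ^+ 2 <= n%:Z.
Proof.
move=> g_inj.
have -> : \sum_j mult_mx (fun=> 1 : int) d i (g j) ^+ 2 =
    \sum_j mult_mx (fun=> 1 : int) d i (g j).
  apply: eq_bigr => j _.
  have [[k def_j]|no_k] :=
      pselect (exists k, standard_mon (g j) = (standard_mon i + U_(k))%MM).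
    by rewrite (mult_mx_next _ def_j).
  by rewrite mult_mx_other.
under eq_bigr => j _ do rewrite mxE.
rewrite exchange_big /= -[n in leRHS]card_ord -natz -sumr_const.
apply: ler_sum => k _.
have [[j0 def_j0]|no_j] := pselect (exists j,
    standard_mon (g j) = (standard_mon i + U_(k))%MM); last first.
  by rewrite big1 // => j _; case: eqP => // ?; case: no_j; exists j.
rewrite (bigD1 j0) //= def_j0 eqxx big1 ?addr0 // => j ne_j.
rewrite -def_j0; case: eqP => // /standard_mon_inj/g_inj ej.
by rewrite ej eqxx in ne_j.
Qed.

(* Over the polynomial ring, scaling row [m] by ['X_[m]] and column [m'] by
   ['X_[m']] identifies the matrix of the generic linear form with that of the
   sum of the variables; so a minor of the former is the corresponding minor
   of the latter times a quotient of two monomials. *)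
Lemma minor_sum_variables (F : fieldType) (alpha : 'I_n -> F) d N
    (f : 'I_N -> 'I_(size (standard_seq d)))
    (g : 'I_N -> 'I_(size (standard_seq d.+1))) :
  \det (mxsub f g (mult_mx alpha d)) != 0 ->
  \det (mxsub f g (mult_mx (fun=> 1 : F) d)) != 0.
Proof.
apply: contra_neq => det0.
pose X (k : 'I_n) : {mpoly F[n]} := 'X_k.
have scale : diag_mx (\row_i 'X_[standard_mon (f i)]) *m mxsub f g (mult_mx X d)
    = mxsub f g (mult_mx (fun=> 1) d) *m
      diag_mx (\row_j 'X_[standard_mon (g j)]).
  apply/matrixP => i j; rewrite mul_diag_mx mul_mx_diag.
  rewrite [LHS]mxE [RHS]mxE [in LHS]mxE [in RHS]mxE ![(\row__ _) _ _]mxE.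
  rewrite [X in _ * X = _]mxE.
  have [[k e]|no_k] := pselect (exists k,
      standard_mon (g j) = (standard_mon (f i) + U_(k))%MM).
    by rewrite !(mult_mx_next _ e) e mpolyXD mul1r.
  by rewrite !mult_mx_other // mulr0 mul0r.
have detX0 : \det (mxsub f g (mult_mx X d)) = 0.
  have /eqP := congr1 determinant scale; rewrite !det_mulmx !det_diag.
  have -> : \det (mxsub f g (mult_mx (fun=> 1 : {mpoly F[n]}) d)) = 0.
    rewrite -(@eq_mult_mx _ (mpolyC n (R:=F) \o fun=> 1)); last first.
      by move=> k /=; rewrite mpolyC1.
    by rewrite -mult_mx_map -map_mxsub det_map_mx det0 rmorph0.
  (* The row scaling has a product of monomials as determinant; it is nonzero in the domain of
     polynomials and cancels. *)
  rewrite mul0r mulf_eq0 => /orP[/prodf_eq0[i _]|/eqP //].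
  by rewrite mxE -msupp_eq0 msuppX.
(* Evaluating the variables at [alpha] turns the generic minor into the given one. *)
have := congr1 (meval alpha) detX0.
rewrite -det_map_mx map_mxsub mult_mx_map rmorph0 => <-.
by rewrite (@eq_mult_mx _ _ alpha) // => k /=; rewrite mevalXU.
Qed.

(** * The weak Lefschetz property in terms of matrices *)

Section Multiplication.
Variable K : fieldType.
Implicit Types (f h : {mpoly K[n]}) (alpha : 'I_n -> K).

Lemma degree_partP d f :
  degree_part d%:Z f <-> forall m, mdeg m != d -> f@_m = 0.
Proof.
split=> [/allP deg_f m|f0].
  by apply: contra_neq_eq; rewrite -mcoeff_msupp => /deg_f/eqP[].
apply/allP=> m; apply: contraLR => ne_md.
by rewrite -mcoeff_eq0 f0.
Qed.

Lemma degree_partB d f h :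
  degree_part d%:Z f -> degree_part d%:Z h -> degree_part d%:Z (f - h).
Proof.
move=> /degree_partP f0 /degree_partP h0; apply/degree_partP=> m ne_md.
by rewrite mcoeffB f0 // h0 // subrr.
Qed.

Definition linear_form alpha : {mpoly K[n]} := \sum_k alpha k *: 'X_k.

Lemma linear_form_degree alpha : degree_part 1 (linear_form alpha).
Proof.
apply/degree_partP=> m ne_m1; rewrite raddf_sum big1 //= => k _.
rewrite mcoeffZ mcoeffX; case: eqP => [mk|]; last by rewrite mulr0.
by rewrite -mk mdeg1 in ne_m1.
Qed.

Lemma degree1_linear_form f :
  degree_part 1 f -> f = linear_form (fun k => f@_U_(k)).
Proof.
move/(degree_partP 1)=> f0; apply/mpolyP=> m; rewrite raddf_sum /=.
have [/mdeg1P[k /eqP ->]|ne_m1] := boolP (mdeg m == 1%N).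
  rewrite (bigD1 k) //= mcoeffZ mcoeffXU eqxx mulr1 big1 ?addr0 // => l ne_lk.
  by rewrite mcoeffZ mcoeffXU (negPf ne_lk) mulr0.
rewrite f0 // big1 // => k _; rewrite mcoeffZ mcoeffX; case: eqP => [mk|].
  by rewrite -mk mdeg1 in ne_m1.
by rewrite mulr0.
Qed.

Lemma mcoeff_linear_formM alpha f m :
  (linear_form alpha * f)@_m = \sum_k alpha k * (f * 'X_k)@_m.
Proof.
rewrite mulrC mulr_sumr raddf_sum; apply: eq_bigr => k _.
by rewrite -scalerAr -mcoeffZ.
Qed.

Lemma degree_part_mul_linear alpha d f :
  degree_part d%:Z f -> degree_part (d.+1)%:Z (linear_form alpha * f).
Proof.
move=> /degree_partP f0; apply/degree_partP=> m ne_md.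
rewrite mcoeff_linear_formM big1 // => k _.
suff -> : (f * 'X_k)@_m = 0 by rewrite mulr0.
apply/eqP; rewrite mcoeff_eq0 (perm_mem (msuppMX _ _)).
apply/mapP=> -[m' supp_m' def_m]; move: supp_m'; apply/negP.
rewrite -mcoeff_eq0 f0 //; apply: contra ne_md => /eqP <-.
by rewrite def_m mdegD mdeg1.
Qed.

Definition coef_row d f : 'rV[K]_(size (standard_seq d)) :=
  \row_i f@_(standard_mon i).

Definition row_mpoly d (u : 'rV[K]_(size (standard_seq d))) : {mpoly K[n]} :=
  \sum_i u 0 i *: 'X_[standard_mon i].

Lemma row_mpolyK d : cancel (@row_mpoly d) (coef_row d).
Proof.
move=> u; apply/rowP=> i; rewrite mxE raddf_sum (bigD1 i) //=.
rewrite mcoeffZ mcoeffX eqxx mulr1 big1 ?addr0 // => j ne_ji.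
by rewrite mcoeffZ mcoeffX (inj_eq (@standard_mon_inj d)) (negPf ne_ji) mulr0.
Qed.

Lemma row_mpoly_degree d u : degree_part d%:Z (@row_mpoly d u).
Proof.
apply/degree_partP=> m ne_md; rewrite raddf_sum big1 //= => i _.
rewrite mcoeffZ mcoeffX; case: eqP => [mi|]; last by rewrite mulr0.
by rewrite -mi mdeg_standard_mon eqxx in ne_md.
Qed.

Lemma coef_rowB d f h : coef_row d (f - h) = coef_row d f - coef_row d h.
Proof. by apply/rowP=> i; rewrite !mxE mcoeffB. Qed.

Lemma coef_row_eq0 d f :
  degree_part d%:Z f -> (monomial_ideal K G f <-> coef_row d f = 0).
Proof.
move=> /degree_partP f0; rewrite monomial_idealP; split=> [f_std|row0 m std_m].
  by apply/rowP=> i; rewrite !mxE f_std ?standard_standard_mon.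
have [deg_m|/f0 //] := eqVneq (mdeg m) d.
have /standard_monP[i ->] : standard m && (mdeg m == d) by rewrite std_m deg_m eqxx.
by have /rowP/(_ i) := row0; rewrite !mxE.
Qed.

Lemma eq_mod_coef_row d f h : degree_part d%:Z f -> degree_part d%:Z h ->
  (eq_mod (monomial_ideal K G) f h <-> coef_row d f = coef_row d h).
Proof.
move=> deg_f deg_h; rewrite /eq_mod (@coef_row_eq0 d); last exact: degree_partB.
by rewrite coef_rowB; split=> [/subr0_eq|->]; rewrite ?subrr.
Qed.

Lemma coef_row_mul_linear alpha d f : degree_part d%:Z f ->
  coef_row d.+1 (linear_form alpha * f) = coef_row d f *m mult_mx alpha d.
Proof.
move=> /degree_partP f0; apply/rowP=> j; rewrite !mxE.
under eq_bigr => i _ do rewrite !mxE mulr_sumr.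
rewrite exchange_big mcoeff_linear_formM; apply: eq_bigr => k _.
(* If the variable ['X_k] divides the monomial of column [j], the quotient [m] is standard, being a
   divisor of a standard monomial, and gives the only nonzero term. Otherwise both sides are
   zero. *)
have [[m def_j]|no_m] := pselect (exists m, standard_mon j = (m + U_(k))%MM).
  have /standard_monP[i def_m] : standard m && (mdeg m == d).
    rewrite (standard_le _ (standard_standard_mon j)) ?def_j ?lem_addr //=.
    by rewrite -eqSS -(mdeg_standard_mon j) def_j mdegD mdeg1 addn1.
  rewrite def_j [in LHS]addmC mcoeffMX (bigD1 i) //= def_m eqxx mulr1n big1.
    by rewrite addr0 mulrC.
  move=> l ne_li; rewrite eqm_add2r (inj_eq (@standard_mon_inj d)).
  by rewrite eq_sym (negPf ne_li) mulr0n mulr0.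
rewrite [RHS]big1 => [|i _]; last first.
  by case: eqP => [def_j|]; [case: no_m; exists (standard_mon i)|rewrite mulr0].
apply/eqP; rewrite mulf_eq0; apply/orP; right.
rewrite mcoeff_eq0 (perm_mem (msuppMX _ _)).
apply/mapP=> -[m _ def_j]; case: no_m; exists m.
by rewrite def_j addmC.
Qed.

Lemma mul_injectiveP alpha d :
  mul_injective (monomial_ideal K G) (linear_form alpha) d%:Z <->
  row_free (mult_mx alpha d).
Proof.
split=> [inj|free f h deg_f deg_h].
  apply: inj_row_free => u u0.
  have deg0 : degree_part d%:Z (0 : {mpoly K[n]}).
    by apply/degree_partP => m _; rewrite mcoeff0.
  have row0 : coef_row d 0 = 0 by apply/rowP=> i; rewrite !mxE mcoeff0.
  have deg_u := row_mpoly_degree u.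
  rewrite -[u]row_mpolyK -row0; apply/(eq_mod_coef_row deg_u deg0).
  apply: inj => //; apply/(@eq_mod_coef_row d.+1).
  - exact/degree_part_mul_linear/row_mpoly_degree.
  - exact: degree_part_mul_linear.
  - by rewrite !coef_row_mul_linear ?row_mpolyK ?row0 ?mul0mx //; apply: row_mpoly_degree.
move/(@eq_mod_coef_row d.+1) => eq_row; apply/(@eq_mod_coef_row d) => //.
apply: (row_free_inj free); rewrite -!coef_row_mul_linear //.
by apply: eq_row; apply: degree_part_mul_linear.
Qed.

Lemma mul_surjectiveP alpha d :
  mul_surjective (monomial_ideal K G) (linear_form alpha) d%:Z <->
  row_full (mult_mx alpha d).
Proof.
rewrite /mul_surjective -[d%:Z + 1]/((d + 1)%N%:Z) addn1.
split=> [surj|full h deg_h].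
  rewrite -sub1mx; apply/row_subP=> j.
  have [f deg_f] := surj _ (row_mpoly_degree (row j 1%:M)).
  have deg_lf := degree_part_mul_linear alpha deg_f.
  move/(eq_mod_coef_row deg_lf (row_mpoly_degree _)).
  by rewrite row_mpolyK coef_row_mul_linear // => <-; apply: submxMl.
have /submxP[u def_h] := submx_full (coef_row d.+1 h) full.
exists (row_mpoly u); first exact: row_mpoly_degree.
have deg_u := row_mpoly_degree u.
apply/(eq_mod_coef_row (degree_part_mul_linear alpha deg_u) deg_h).
by rewrite coef_row_mul_linear // row_mpolyK def_h.
Qed.

Lemma mul_injective_neg ell d :
  mul_injective (monomial_ideal K G) ell (Negz d).
Proof.
have deg0 f : degree_part (Negz d) f -> f = 0.
  move=> /allP deg_f; apply/eqP; rewrite -msupp_eq0.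
  by case: (msupp f) deg_f => // m s /(_ m); rewrite mem_head => /(_ isT).
move=> f h /deg0 -> /deg0 -> _; apply/monomial_idealP=> m _.
by rewrite subrr mcoeff0.
Qed.

(** Only natural degrees remain: in negative degree the source is zero, so the map is injective. *)
Lemma weak_lefschetz_mult_mx :
  weak_lefschetz (monomial_ideal K G) <->
  exists alpha, forall d, row_free (mult_mx alpha d) || row_full (mult_mx alpha d).
Proof.
split=> [[ell /degree1_linear_form -> wl]|[alpha wl]].
  exists (fun k => ell@_U_(k)) => d; apply/orP.
  by have [/mul_injectiveP|/mul_surjectiveP] := wl d%:Z; [left|right].
exists (linear_form alpha); first exact: linear_form_degree.
case=> d; last by left; apply: mul_injective_neg.
by have /orP[/mul_injectiveP|/mul_surjectiveP] := wl d; [left|right].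
Qed.

End Multiplication.
End StandardMonomials.

(** * Counting standard monomials *)

Section StandardSize.
Variables (n : nat) (G : set 'X_{1..n.+1}) (u : 'X_{1..n.+1}).
Hypothesis standard_le_u : forall m, standard G m -> (m <= u)%MM.

Lemma size_standard_le d : (size (standard_seq G d) <= 'C(d + n, d))%N.
Proof. by rewrite -size_basis size_filter count_size. Qed.

(** The complement [m] to [u - m] embeds the standard monomials of degree [d] into all monomials of
    the complementary degree. *)
Lemma size_standard_le_sym d :
  (size (standard_seq G d) <= 'C(mdeg u - d + n, mdeg u - d))%N.
Proof.
rewrite -size_basis -(size_map (fun m => u - m)%MM).
have subK m : m \in standard_seq G d -> (u - m + m)%MM = u.
  by rewrite mem_standard_seq => /andP[/standard_le_u le_mu _]; rewrite submK.
apply: uniq_leq_size.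
  rewrite map_inj_in_uniq ?standard_seq_uniq // => m1 m2 /subK e1 /subK e2 e.
  by apply: (@addmI _ (u - m1)%MM); rewrite e1 e e2.
move=> _ /mapP[m m_d ->]; rewrite -basis_cover -{2}(subK m m_d) mdegD.
by move: m_d; rewrite mem_standard_seq => /andP[_ /eqP ->]; rewrite addnK.
Qed.

End StandardSize.

Lemma standard_lt (n : nat) (K : fieldType) (G : set 'X_{1..n}) k e m :
  monomial_ideal K G ('X_k ^+ e) -> standard G m -> (m k < e)%N.
Proof.
rewrite mpolyXn => /monomial_ideal_mpolyX nstd std_m.
rewrite ltnNge; apply: contra nstd => le_em; apply: standard_le std_m.
apply/mnm_lepP=> i; rewrite mulmnE mnm1E.
by case: eqP => [<-|//]; rewrite mul1n.
Qed.

Lemma mdeg3 (m : 'X_{1..3}) : mdeg m = (m 0%R + m 1%R + m 2%R)%N.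
Proof.
rewrite mdegE !big_ord_recl big_ord0 addn0 addnA.
by congr (m _ + m _ + m _)%N; apply/val_inj.
Qed.

(* Either [d] or the complementary degree [a + b + c - 3 - d] is an [e] with
   [2 * e + 3 <= a + b + c]; there are at most [binom (e + 2) 2] monomials. *)
Lemma size_standard3 (R : realType) (K : fieldType) (G : set 'X_{1..3})
    (a b c d : nat) :
  monomial_ideal K G ('X_(0 : 'I_3) ^+ a) ->
  monomial_ideal K G ('X_(1 : 'I_3) ^+ b) ->
  monomial_ideal K G ('X_(2 : 'I_3) ^+ c) ->
  (size (standard_seq G d))%:R <= binom2 (1 / 2 * (a + b + c)%:R + 2 :> R).
Proof.
move=> hx hy hz; have s_ge0 : 0 <= (a + b + c)%:R :> R by [].
have [std0|no_std] := boolP (has predT (standard_seq G d)); last first.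
  move: no_std; rewrite has_predT -eqn0Ngt => /eqP ->.
  by rewrite /binom2; nra.
(* The top-degree monomial of the complete intersection. The predecessors are not truncated: a
   standard monomial exists here, which forces [a], [b] and [c] to be positive. *)
pose u := [multinom nth 0 [:: a.-1; b.-1; c.-1] i | i < 3]%N.
have lt_abc m : standard G m ->
    [/\ m 0%R < a, m 1%R < b & m 2%R < c]%N.
  move=> std_m; split; last exact: standard_lt hz std_m.
    exact: standard_lt hx std_m.
  exact: standard_lt hy std_m.
have le_u m : standard G m -> (m <= u)%MM.
  case/lt_abc=> ltx lty ltz; apply/mnm_lepP=> i; rewrite mnmE.
  have: [|| i == 0, i == 1 | i == 2] by case: i => -[|[|[|]]].
  by case/or3P=> /eqP ->; [move: ltx|move: lty|move: ltz] => /=; lia.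
have mdeg_u : (mdeg u + 3 = a + b + c)%N.
  have [m m_d _] := hasP std0; move: m_d.
  rewrite mem_standard_seq => /andP[/lt_abc[ltx lty ltz] _].
  by rewrite mdeg3 !mnmE /=; lia.
have [e le_e le_se] : exists2 e, (2 * e + 3 <= a + b + c)%N &
    (size (standard_seq G d) <= 'C(e + 2, e))%N.
  have [le_d|lt_d] := leqP (2 * d + 3) (a + b + c).
    by exists d => //; apply: size_standard_le.
  exists (mdeg u - d)%N; first by lia.
  exact: size_standard_le_sym.
move: (size _) le_se => N; have := bin_ffact (e + 2) 2.
rewrite -bin_sub ?leq_addl // addnK (_ : 2`! = 2)%N // addn2.
rewrite 2!ffactnS /= ffactn0 => binE le_N.
have {le_N binE} : (2 * N <= (e + 2) * (e + 1))%N by lia.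
rewrite -(ler_nat R) !natrM !natrD => le_N.
move: le_e; rewrite -(ler_nat R) natrD natrM => le_e.
have e_ge0 : 0 <= e%:R :> R by [].
(* With [s = a + b + c], the bound on [e] gives [e + 2 <= s / 2 + 2], so [(e + 2) * (e + 1) / 2] is
   at most [binom2 (s / 2 + 2)]. *)
rewrite /binom2; nra.
Qed.

(** * Comparison of minors with the characteristic, and the theorem *)

(** Squaring removes the factor 1/2 from the exponent, to match the bound on the squared
    determinant. *)
Lemma powR_half_lt (R : realType) (B x : R) (N : nat) :
  0 <= x -> N%:R <= B -> 3 `^ (1 / 2 * B) < x -> (3 ^ N)%:R < x ^+ 2.
Proof.
move=> x_ge0 leNB lt_x; rewrite natrX -[3 ^+ N]powR_mulrn //.
apply: (@le_lt_trans _ _ (3 `^ B)); first by apply: ler_powR; rewrite ?ler1n.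
have -> : B = 1 / 2 * B * 2%:R by field.
rewrite powRrM powR_mulrn ?powR_ge0 //.
by rewrite ltr_pXn2r // nnegrE powR_ge0.
Qed.

(** A nonzero integer of absolute value below [p] is not divisible by [p]. *)
Lemma intr_neq0_small (K : fieldType) (p : nat) (z : int) :
  p \in [pchar K] -> z != 0 -> z ^+ 2 < (p ^ 2)%:Z -> z%:~R != 0 :> K.
Proof.
move=> charK nz_z lt_z.
have lt_zp : (`|z| < p)%N.
  rewrite -(ltn_exp2r _ _ (isT : 0 < 2)%N) -ltz_nat.
  by rewrite -abszX abszE ger0_norm ?sqr_ge0.
rewrite -(dvdz_pcharf charK); apply: contraL lt_zp => /dvdn_leq le_pz.
by rewrite -leqNgt le_pz // absz_gt0.
Qed.

Theorem proposition9p9 (R : realType) (F K : fieldType) (G : set 'X_{1..3})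
    (a b c p : nat)
    (charF : [pchar F] =i pred0)
    (wlF : weak_lefschetz (monomial_ideal F G))
    (infK : infinite_set [set: K])
    (artK : artinian_ideal (monomial_ideal K G))
    (hx : monomial_ideal K G ('X_(0 : 'I_3) ^+ a))
    (hy : monomial_ideal K G ('X_(1 : 'I_3) ^+ b))
    (hz : monomial_ideal K G ('X_(2 : 'I_3) ^+ c))
    (charK : p \in [pchar K])
    (hp : 3 `^ (1 / 2 * binom2 (1 / 2 * (a + b + c)%:R + 2)) < p%:R :> R) :
  weak_lefschetz (monomial_ideal K G).
Proof.
have [alpha wl] := (weak_lefschetz_mult_mx G F).1 wlF.
apply/weak_lefschetz_mult_mx; exists (fun=> 1) => d.
(* The size of the minor is the number of standard monomials of degree [e]: [e = d] serves for
   injectivity and [e = d.+1] for surjectivity. *)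
have transfer e (f : 'I_(size (standard_seq G e)) -> 'I_(size (standard_seq G d)))
    (g : 'I_(size (standard_seq G e)) -> 'I_(size (standard_seq G d.+1))) :
    injective g -> \det (mxsub f g (mult_mx G alpha d)) != 0 ->
    \det (mxsub f g (mult_mx G (fun=> 1 : K) d)) != 0.
  move=> g_inj /minor_sum_variables.
  (* A single integer whose images in [F] and [K] are the two minors of the sum of the variables; it
     is nonzero because its image in [F] is. *)
  pose D : int := \det (mxsub f g (mult_mx G (fun=> 1) d)).
  have intrD (L : fieldType) :
      \det (mxsub f g (mult_mx G (fun=> 1 : L) d)) = D%:~R.
    by rewrite -det_map_mx map_mxsub mult_mx_map.
  rewrite !intrD => nz_D; apply: (intr_neq0_small charK).
    by apply: contra_neq nz_D => ->.
  have /le_lt_trans : D ^+ 2 <= (3 ^ size (standard_seq G e))%:Z.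
    apply: hadamard_int => i; under eq_bigr => j _ do rewrite mxE.
    exact: mult_mx_row_norm.
  apply; rewrite ltz_nat -(ltr_nat R) [in ltRHS]natrX.
  by apply: powR_half_lt hp => //; apply: size_standard3 hx hy hz.
have /orP[/row_free_minorP[g g_inj nz]|/row_full_minorP[f f_inj nz]] := wl d.
  apply/orP; left; apply/row_free_minorP; exists g => //.
  exact: transfer nz.
apply/orP; right; apply/row_full_minorP; exists f => //.
exact: transfer nz.
Qed.
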